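(* Let $\mu$ be a probability measure on $\mathbb{C}$ with compact support, and let $X_1, \ldots, X_n$ be iid random variables with distribution $\mu$. Then for every $\varepsilon > 0$ there exist constants $C, c > 0$ (depending only on $\mu$ and $\varepsilon$) such that, for every $n\ge 1$, with probability at least $1 - C e^{-cn}$ the polynomial $p_n(z) := \prod_{j=1}^n (z - X_j)$ has no critical points outside $N_\mu(\varepsilon)$.
   Context: For a probability measure $\mu$ on $\mathbb{C}$, the Cauchy–Stieltjes transform is $m_\mu(z) := \int_{\mathbb{C}} \frac{d\mu(x)}{z-x}$ for $z \notin \operatorname{supp}(\mu)$. Let $M_\mu := \{ z \in \mathbb{C}\setminus \operatorname{supp}(\mu) : m_\mu(z) = 0\}$, and for $\varepsilon>0$ let $N_\mu(\varepsilon) := \{ z \in \mathbb{C} : \operatorname{dist}(z, \operatorname{supp}(\mu) \cup M_\mu) < \varepsilon\}$, where $\operatorname{dist}(z,D)=\inf_{w\in D}|z-w|$. A critical point of a polynomial is a zero of its derivative. *)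

(* Defs.v *)
(* mathcomp-analysis over an abstract R : realType.
   The complex plane C is represented, for measure-theoretic purposes, by the
   measurable space R * R (product sigma-algebra = Borel sets of R^2), and,
   for algebraic purposes, by the complex numbers R[i] (real-closed's complex),
   via the identification toC. *)
From HB Require Import structures.
From mathcomp Require Import all_boot all_order all_algebra.
From mathcomp Require Import complex.
From mathcomp Require Import all_classical all_reals all_analysis.
Import Order.TTheory GRing.Theory Num.Theory.
Import numFieldNormedType.Exports.
Set Implicit Arguments. Unset Strict Implicit. Unset Printing Implicit Defensive.
Local Open Scope ring_scope.
Local Open Scope classical_set_scope.

Definition toC {R : realType} (x : (R * R)%type) : R[i] := (x.1 +i* x.2)%C.

Definition supp (R : realType) (mu : probability (R * R)%type R) : set (R * R)%type :=
  [set x : (R * R)%type | forall r : R, 0 < r -> (0 < mu [set y : (R * R)%type | (`|toC y - toC x| < (r%:C)%C)%R])%E].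

Definition suppC (R : realType) (mu : probability (R * R)%type R) : set R[i] :=
  toC @` supp mu.

Definition cauchy_transform (R : realType) (mu : probability (R * R)%type R)
  (z : R[i]) : R[i] :=
  ((Rintegral mu setT (fun x => complex.Re ((z - toC x)^-1)))
   +i* (Rintegral mu setT (fun x => complex.Im ((z - toC x)^-1))))%C.

Definition zeros_cauchy (R : realType) (mu : probability (R * R)%type R) : set R[i] :=
  [set z | ~ suppC mu z /\ cauchy_transform mu z = 0].

Definition Nmu (R : realType) (mu : probability (R * R)%type R) (eps : R) : set R[i] :=
  [set z | exists w, (suppC mu w \/ zeros_cauchy mu w) /\ `|z - w| < (eps%:C)%C].

Definition independent_rvs (R : realType) (d : measure_display) (Omega : measurableType d)
  (P : probability Omega R) (n : nat) (X : 'I_n -> Omega -> (R * R)%type) : Prop :=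
  forall A : 'I_n -> set (R * R)%type, (forall i, measurable (A i)) ->
    P (\bigcap_(i in [set: 'I_n]) (X i @^-1` A i)) = (\prod_(i < n) P (X i @^-1` A i))%E.

Definition rand_poly (R : realType) (Omega : Type) (n : nat)
  (X : 'I_n -> Omega -> (R * R)%type) (w : Omega) : {poly R[i]} :=
  \prod_(i < n) ('X - (toC (X i w))%:P).

(* Main.v *)
Require Import Defs.
From HB Require Import structures.
From mathcomp Require Import all_boot all_order all_algebra.
From mathcomp Require Import complex.
From mathcomp Require Import all_classical all_reals all_analysis.
From mathcomp Require Import measurable_realfun ring lra.
Import Order.TTheory GRing.Theory Num.Theory.
Import numFieldNormedType.Exports.
Set Implicit Arguments. Unset Strict Implicit. Unset Printing Implicit Defensive.
Local Open Scope ring_scope.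
Local Open Scope classical_set_scope.

(** Away from the sample points, p_n'/p_n is the sum of 1/(z - X_j), so a critical point that is not
    a sample point is a zero of this sum, an empirical version of n m_mu(z). A point z0 outside
    N_mu(eps) has distance at least eps from the support and m_mu(z0) is nonzero, so its real or
    imaginary part is a number a different from 0. The same part of 1/(z0 - x) is bounded on the
    support, and a Chernoff bound keeps its sum over the sample within n|a|/4 of n a, up to
    exponentially small probability ([exp_concentrated_ae_bounded]). Since z -> 1/(z - x) is
    Lipschitz at distance eps from x, the sum stays nonzero at every z close to z0 and eps-far from
    the samples ([exp_likely_sum_inv_neq0], [exp_likely_critical_locally]).

    Finitely many exponential bounds combine into one, so the local statement extends to compact
    sets ([exp_likely_compact]). A Gauss-Lucas argument ([critical_point_in_square]) confines the
    critical points outside N_mu(eps) to a fixed square. Throughout, the samples may be taken in the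
    support, whose complement is null ([measure_setC_supp]). *)

(** * Events of exponentially high probability *)

Definition iid_sample (R : realType) (mu : probability (R * R)%type R) (n : nat)
    (d : measure_display) (Omega : measurableType d) (P : probability Omega R)
    (X : 'I_n -> Omega -> (R * R)%type) : Prop :=
  [/\ forall i, measurable_fun setT (X i),
      forall i (A : set (R * R)%type), measurable A -> P (X i @^-1` A) = mu A
    & independent_rvs P X].

(** The constants come before n and the probability space, so they depend on [mu] and [Ev] only.
    Asking for a measurable set inside the event avoids proving measurability of events that
    quantify over uncountably many z. *)
Definition exp_likely (R : realType) (mu : probability (R * R)%type R)
    (Ev : forall n, ('I_n -> (R * R)%type) -> Prop) : Prop :=
  exists C c : R, 0 < C /\ 0 < c /\
    forall n : nat, (0 < n)%N ->
    forall (d : measure_display) (Omega : measurableType d) (P : probability Omega R)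
           (X : 'I_n -> Omega -> (R * R)%type),
      iid_sample mu P X ->
      exists E : set Omega, measurable E /\
        (forall w, E w -> Ev n (X ^~ w)) /\
        ((1 - C * expR (- (c * n%:R)))%:E <= P E)%E.

Lemma exp_likely_sub (R : realType) (mu : probability (R * R)%type R)
    (Ev Ev' : forall n, ('I_n -> (R * R)%type) -> Prop) :
  (forall n x, (0 < n)%N -> Ev n x -> Ev' n x) ->
  exp_likely mu Ev -> exp_likely mu Ev'.
Proof.
move=> sub [C [c [C0 [c0 H]]]]; exists C, c; split=> //; split=> // n n0 d Om P X iX.
have [E [mE [EE PE]]] := H n n0 d Om P X iX.
by exists E; split=> //; split=> // w /EE; exact: sub.
Qed.

Lemma exp_likely_of_measure1 (R : realType) (mu : probability (R * R)%type R)
    (A : set (R * R)%type) : measurable A -> mu (~` A) = 0 ->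
  exp_likely mu (fun n x => forall i, A (x i)).
Proof.
move=> mA A0; exists 1, 1; split=> //; split=> // n n0 d Om P X [mX dX _].
have mXA i : measurable (X i @^-1` (~` A)).
  by rewrite -[X in measurable X]setTI; apply: mX => //; exact: measurableC.
exists (~` \big[setU/set0]_(i < n) X i @^-1` (~` A)); split.
  by apply: measurableC; apply: bigsetU_measurable.
split.
  move=> w nw i; apply: contrapT => nA; apply: nw.
  by rewrite (bigD1 i)//=; left.
rewrite probability_setC; last exact: bigsetU_measurable.
suff -> : P (\big[setU/set0]_(i < n) X i @^-1` (~` A)) = 0.
  by rewrite sube0 lee_fin gerBl// mul1r expR_ge0.
apply/eqP; rewrite eq_le measure_ge0 andbT.
(* Measurability is carried through the induction because subadditivity asks for it. *)
apply: (@proj2 (measurable (\big[setU/set0]_(i < n) X i @^-1` (~` A)))).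
elim/big_ind: _ => [|B D [mB B0] [mD D0]|i _].
- by rewrite measure0; split.
- split; first exact: measurableU.
  by rewrite (le_trans (measureU2 _ _ _))// -[leRHS]adde0 leeD.
- by split=> //; rewrite dX ?A0//; exact: measurableC.
Qed.

(** Union bound on the complements: the prefactors add up and the smaller rate survives. *)
Lemma exp_likely_and (R : realType) (mu : probability (R * R)%type R)
    (Ev Ev' : forall n, ('I_n -> (R * R)%type) -> Prop) :
  exp_likely mu Ev -> exp_likely mu Ev' ->
  exp_likely mu (fun n x => Ev n x /\ Ev' n x).
Proof.
move=> [C [c [C0 [c0 H]]]] [C' [c' [C'0 [c'0 H']]]].
exists (C + C'), (Num.min c c'); split; first exact: addr_gt0.
split; first by rewrite lt_min c0.
move=> n n0 d Om P X iX.
have [E [mE [EE PE]]] := H n n0 d Om P X iX.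
have [E' [mE' [EE' PE']]] := H' n n0 d Om P X iX.
exists (E `&` E'); split; first exact: measurableI.
split; first by move=> w [/EE ? /EE'].
rewrite -[E `&` E']setCK setCI probability_setC; last first.
  by apply: measurableU; exact: measurableC.
have U2 : (P (~` E `|` ~` E') <= P (~` E) + P (~` E'))%E.
  by apply: measureU2; exact: measurableC.
have fU : P (~` E `|` ~` E') \is a fin_num by rewrite fin_num_measure//; apply: measurableU; exact: measurableC.
have fE : P E \is a fin_num by rewrite fin_num_measure.
have fE' : P E' \is a fin_num by rewrite fin_num_measure.
move: U2 PE PE'; rewrite !probability_setC//.
rewrite -(fineK fU) -(fineK fE) -(fineK fE') -!EFinB -EFinD !lee_fin => U2 PE PE'.
have e1 : expR (- (c * n%:R)) <= expR (- (Num.min c c' * n%:R)).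
  by rewrite ler_expR lerN2 ler_wpM2r// ge_min lexx.
have e2 : expR (- (c' * n%:R)) <= expR (- (Num.min c c' * n%:R)).
  by rewrite ler_expR lerN2 ler_wpM2r// ge_min lexx orbT.
have := ler_wpM2l (ltW C0) e1; have := ler_wpM2l (ltW C'0) e2.
lra.
Qed.

                                                                                
                                                                              
                          
(** * Chernoff bound for the number of samples in a set *)

(** Exponential Markov inequality for a binomial count. Instead of integrating over [Omega], the
    proof cuts it into the 2^n cells recording which samples fall in [A]; by independence each cell
    has a product weight, and the moment generating function becomes a finite sum. *)
Lemma chernoff_count (R : realType) (mu : probability (R * R)%type R)
    (A : set (R * R)%type) (eta : R) : measurable A -> 0 < eta ->
  exp_likely mu
    (fun n x => \sum_(i < n) \1_A (x i) < n%:R * (fine (mu A) + eta)).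
Proof.
move=> mA eta0; set p := fine (mu A).
have muA : mu A = p%:E by rewrite fineK// fin_num_measure.
have p0 : 0 <= p by rewrite -lee_fin -muA.
have p1 : p <= 1 by rewrite -lee_fin -muA probability_le1.
(* The tilt [t] is at most 1/4, for the quadratic bound on exp, and at most eta/4, so that 2 t^2 <=
   t eta / 2 and the rate t eta / 2 remains. *)
pose t := Num.min 1 eta / 4.
have t0 : 0 < t by rewrite divr_gt0// lt_min ltr01.
have t1 : t * 4 <= 1 by rewrite /t divfK// ge_min lexx.
have t2 : t * 4 <= eta by rewrite /t divfK// ge_min lexx orbT.
(* From exp(-t) >= 1 - t, and (1 + t + 2 t^2)(1 - t) = 1 + t^2 - 2 t^3 >= 1. *)
have et : expR t <= 1 + t + 2 * t ^+ 2.
  have h1 : 1 - t <= expR (- t) by exact: expR_ge1Dx.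
  have h2 := expR_gt0 t.
  have h3 : expR t * expR (- t) = 1 by rewrite expRN divff// gt_eqF.
  have h4 : expR t * (1 - t) <= 1 by have := ler_wpM2l (ltW h2) h1; rewrite h3.
  have h5 : 1 <= (1 + t + 2 * t ^+ 2) * (1 - t) by nra.
  have : (1 + t + 2 * t ^+ 2 - expR t) * (1 - t) >= 0 by lra.
  by rewrite pmulr_lge0 ?subr_ge0; lra.
pose c := t * eta / 2.
have c0 : 0 < c by rewrite divr_gt0// mulr_gt0.
(* [q] is the law of the indicator of [A], [wt] its exponential tilt centred at the threshold;
   [rate] bounds the tilted moment of one sample. *)
pose q (b : bool) := if b then p else 1 - p.
pose wt (b : bool) : R := expR (t * (b%:R - (p + eta))).
have rate : q true * wt true + q false * wt false <= expR (- c).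
  have -> : q true * wt true + q false * wt false =
      (1 + p * (expR t - 1)) * expR (- t * (p + eta)).
    rewrite /q /wt /= !mulrBr mulr1 mulr0 sub0r expRD.
    by rewrite mulNr; ring.
  have h : 1 + p * (expR t - 1) <= expR (p * (expR t - 1)) by exact: expR_ge1Dx.
  apply: (le_trans (ler_wpM2r (expR_ge0 _) h)).
  rewrite -expRD ler_expR /c.
  have : p * (expR t - 1) <= p * (t + 2 * t ^+ 2) by rewrite ler_wpM2l//; lra.
  have : p * t ^+ 2 <= 1 * t ^+ 2 by rewrite ler_wpM2r// sqr_ge0.
  have : t * (t * 4) <= t * eta by rewrite ler_wpM2l// ltW.
  nra.
exists 1, c; split=> //; split=> // n n0 d Om P X [mX dX iX].
pose cell (b : bool) := if b then A else ~` A.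
have mcell b : measurable (cell b) by case: b => //; exact: measurableC.
have mucell b : mu (cell b) = (q b)%:E.
  by case: b => //=; rewrite probability_setC// muA.
pose Ew (J : {ffun 'I_n -> bool}) := \bigcap_(i in [set: 'I_n]) (X i @^-1` cell (J i)).
have mEw J : measurable (Ew J).
  apply: fin_bigcap_measurable => // i _.
  by rewrite -[X in measurable X]setTI; apply: mX.
have PEw J : P (Ew J) = (\prod_i q (J i))%:E.
  rewrite /Ew (iX (fun i => cell (J i)))// -prodEFin.
  by apply: eq_bigr => i _; rewrite dX// mucell.
pose bad (J : {ffun 'I_n -> bool}) := n%:R * (p + eta) <= \sum_i (J i)%:R.
have mB : measurable (\big[setU/set0]_(J | bad J) Ew J) by apply: bigsetU_measurable.
exists (~` \big[setU/set0]_(J | bad J) Ew J); split; first exact: measurableC.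
split.
  move=> w nw; rewrite ltNge; apply/negP => hb; apply: nw.
  pose J := [ffun i => `[< A (X i w) >]].
  have bJ : bad J.
    rewrite /bad (le_trans hb)//; apply: ler_sum => i _.
    rewrite ffunE indicE; case: asboolP => h; first by rewrite mem_set.
    by rewrite memNset.
  rewrite (bigD1 J)//=; left => i _ /=; rewrite ffunE /cell.
  by case: asboolP.
rewrite probability_setC//.
have bound : (P (\big[setU/set0]_(J | bad J) Ew J) <=
    (\sum_(J : {ffun 'I_n -> bool} | bad J) \prod_i q (J i))%:E)%E.
  rewrite -sumEFin.
  apply: (@proj2 (measurable (\big[setU/set0]_(J | bad J) Ew J))).
  elim/big_ind2: _ => [|B x D y [mBB Bx] [mD Dy]|J _].
  - by rewrite measure0; split.
  - split; first exact: measurableU.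
    by rewrite (le_trans (measureU2 _ _ _))// leeD.
  - by split=> //; rewrite PEw.
have q0 b : 0 <= q b by case: b => //=; rewrite subr_ge0.
have sumle : \sum_(J : {ffun 'I_n -> bool} | bad J) \prod_i q (J i) <= expR (- (c * n%:R)).
  (* On a bad cell the product of the tilts is at least 1, so inserting it and summing over all
     cells only increases the sum; the full sum factors into an n-th power. *)
  apply: (@le_trans _ _ (\sum_(J : {ffun 'I_n -> bool}) \prod_i (q (J i) * wt (J i)))).
    rewrite [leRHS](bigID bad)/= -[leLHS]addr0 lerD//; last first.
      by apply: sumr_ge0 => J _; apply: prodr_ge0 => i _; rewrite mulr_ge0// expR_ge0.
    apply: ler_sum => J bJ; rewrite big_split/= ler_peMr ?prodr_ge0//.
    rewrite -expR_sum -mulr_sumr.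
    have -> : \sum_(i < n) ((J i)%:R - (p + eta)) = \sum_i (J i)%:R - n%:R * (p + eta).
      by rewrite sumrB sumr_const card_ord mulr_natl.
    by rewrite -[X in X <= _]expR0 ler_expR mulr_ge0 ?(ltW t0)// subr_ge0.
  rewrite -(bigA_distr_bigA (fun (i : 'I_n) b => q b * wt b)) /=.
  under eq_bigr do rewrite big_bool/=.
  rewrite prodr_const card_ord -mulNr expRM_natr.
  by rewrite lerXn2r// nnegrE ?addr_ge0 ?mulr_ge0 ?expR_ge0// ?(q0 true) ?(q0 false).
have fB : P (\big[setU/set0]_(J | bad J) Ew J) \is a fin_num by rewrite fin_num_measure.
move: bound; rewrite -(fineK fB) -EFinB !lee_fin; lra.
Qed.

(** * Concentration of empirical means of bounded functions *)

Definition exp_concentrated (R : realType) (mu : probability (R * R)%type R)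
    (h : R * R -> R) : Prop :=
  forall eta : R, 0 < eta -> exp_likely mu
    (fun n x => `|\sum_(i < n) h (x i) - n%:R * Rintegral mu setT h| <= n%:R * eta).

Lemma Rintegral_indic (R : realType) (mu : probability (R * R)%type R)
    (A : set (R * R)%type) : measurable A ->
  Rintegral mu setT \1_A = fine (mu A).
Proof. by move=> mA; rewrite /Rintegral integral_indic// setIT. Qed.

(** The Chernoff bound for [A] controls the upper deviation, the one for its complement the lower
    deviation. *)
Lemma exp_concentrated_indic (R : realType) (mu : probability (R * R)%type R)
    (A : set (R * R)%type) : measurable A -> exp_concentrated mu \1_A.
Proof.
move=> mA eta eta0; rewrite Rintegral_indic//.
have up := chernoff_count mu mA eta0.
have := chernoff_count mu (measurableC mA) eta0.
rewrite probability_setC// => lo.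
move: (exp_likely_and up lo); apply: exp_likely_sub => n x n0 [].
have -> : fine (1 - mu A)%E = 1 - fine (mu A).
  by rewrite fineB// fin_num_measure.
have -> : \sum_(i < n) \1_(~` A) (x i) = n%:R - \sum_(i < n) \1_A (x i) :> R.
  rewrite -[n in n%:R]card_ord -sumr_const -sumrB; apply: eq_bigr => i _.
  by rewrite !indicE in_setC; case: (_ \in _); rewrite ?subrr ?subr0.
by rewrite ler_norml => h1 h2; apply/andP; split; lra.
Qed.

Lemma exp_concentratedZ (R : realType) (mu : probability (R * R)%type R)
    (k : R) (h : R * R -> R) : mu.-integrable setT (EFin \o h) ->
  exp_concentrated mu h -> exp_concentrated mu (fun x => k * h x).
Proof.
move=> ih ch eta eta0; rewrite RintegralZl//.
(* Dividing by |k| + 1 instead of |k| covers k = 0. *)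
have k0 : 0 < `|k| + 1 by rewrite ltr_wpDl.
apply: exp_likely_sub (ch (eta / (`|k| + 1)) _) => [n x n0|]; last exact: divr_gt0.
rewrite -mulr_sumr [n%:R * (k * _)]mulrCA -mulrBr normrM => le1.
apply: (le_trans (ler_wpM2l (normr_ge0 k) le1)).
rewrite mulrCA ler_wpM2l// mulrA ler_pdivrMr// mulrC ler_wpM2l ?(ltW eta0)//.
by rewrite lerDl.
Qed.

Lemma exp_concentratedD (R : realType) (mu : probability (R * R)%type R)
    (g h : R * R -> R) :
  mu.-integrable setT (EFin \o g) -> mu.-integrable setT (EFin \o h) ->
  exp_concentrated mu g -> exp_concentrated mu h ->
  exp_concentrated mu (fun x => g x + h x).
Proof.
move=> ig ih cg ch eta eta0; rewrite RintegralD//.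
have e0 : 0 < eta / 2 by rewrite divr_gt0.
move: (exp_likely_and (cg _ e0) (ch _ e0)); apply: exp_likely_sub => n x n0 [h1 h2].
rewrite big_split/= mulrDr opprD addrACA.
apply: (le_trans (ler_normD _ _)); apply: (le_trans (lerD h1 h2)).
by rewrite -mulrDr -splitr.
Qed.

(** Three errors of eta/3: from h to g on the sample, from the sum of g to its mean, and from the
    mean of g to that of h. *)
Lemma exp_concentrated_uniform_limit (R : realType)
    (mu : probability (R * R)%type R) (h : R * R -> R) :
  mu.-integrable setT (EFin \o h) ->
  (forall eta : R, 0 < eta -> exists g : R * R -> R,
     [/\ mu.-integrable setT (EFin \o g), exp_concentrated mu g
       & forall x, `|h x - g x| <= eta]) ->
  exp_concentrated mu h.
Proof.
move=> ih H eta eta0.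
have e0 : 0 < eta / 3 by rewrite divr_gt0.
have [g [ig cg hg]] := H _ e0.
have intle : `|Rintegral mu setT h - Rintegral mu setT g| <= eta / 3.
  have ihg : mu.-integrable setT (EFin \o (fun x => h x - g x)).
    by rewrite compreBr//; exact: integrableB.
  rewrite -RintegralB//; apply: (le_trans (le_normr_Rintegral _ ihg)) => //.
  have -> : eta / 3 = Rintegral mu setT (fun=> eta / 3).
    by rewrite Rintegral_cst//= probability_setT mulr1.
  apply: le_Rintegral => //; first exact: integrable_norm.
  exact: finite_measure_integrable_cst.
apply: exp_likely_sub (cg _ e0) => n x n0 le1.
have n0' : 0 <= n%:R :> R by [].
have le2 : `|\sum_(i < n) h (x i) - \sum_(i < n) g (x i)| <= n%:R * (eta / 3).
  rewrite -sumrB; apply: (le_trans (ler_norm_sum _ _ _)).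
  rewrite mulr_natl -[X in _ *+ X]card_ord -sumr_const.
  by apply: ler_sum => i _.
have le3 : `|n%:R * Rintegral mu setT g - n%:R * Rintegral mu setT h| <= n%:R * (eta / 3).
  by rewrite -mulrBr normrM ger0_norm// distrC ler_wpM2l.
have -> : \sum_(i < n) h (x i) - n%:R * Rintegral mu setT h =
  (\sum_(i < n) h (x i) - \sum_(i < n) g (x i)) +
  (\sum_(i < n) g (x i) - n%:R * Rintegral mu setT g) +
  (n%:R * Rintegral mu setT g - n%:R * Rintegral mu setT h) by ring.
have -> : n%:R * eta = n%:R * (eta / 3) + n%:R * (eta / 3) + n%:R * (eta / 3) by field.
by apply: (le_trans (ler_normD _ _)); rewrite lerD// (le_trans (ler_normD _ _))// lerD.
Qed.

(** The sum rounds y down to a multiple of s: step j contributes s as soon as y reaches (j+1)s. *)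
Lemma layer_cake_approx (R : realType) (s y : R) (N : nat) : 0 < s -> 0 <= y ->
  y < N.+1%:R * s ->
  let g := \sum_(j < N) s * (j.+1%:R * s <= y)%R%:R in g <= y <= g + s.
Proof.
move=> s0 y0.
elim: N => [|N IH] yN /=.
  by rewrite big_ord0 y0 add0r ltW// (lt_le_trans yN)// mul1r.
rewrite big_ord_recr/=; have [yle|ylt] := leP (N.+1%:R * s) y; last first.
  by rewrite mulr0 addr0; exact: IH.
(* Once the top step is reached, so are all the lower ones. *)
have -> : \sum_(j < N) s * (j.+1%:R * s <= y)%R%:R = N%:R * s.
  rewrite mulr_natl -[X in _ *+ X]card_ord -sumr_const.
  apply: eq_bigr => j _; rewrite (le_trans _ yle) ?mulr1//.
  by rewrite ler_wpM2r ?(ltW s0)// ler_nat ltnS ltnW.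
move: yle yN; rewrite mulr1 -!natr1; lra.
Qed.

(** A bounded nonnegative function is a uniform limit of combinations of indicators of its
    superlevel sets; a signed one is first shifted by the constant M. *)
Lemma exp_concentrated_bounded (R : realType) (mu : probability (R * R)%type R)
    (h : R * R -> R) (M : R) : measurable_fun setT h ->
  (forall x, `|h x| <= M) -> exp_concentrated mu h.
Proof.
wlog h0 : h M / forall x, 0 <= h x => [wl|] mh hM.
  have -> : h = (fun x => (h x + M) + (- M) * \1_setT x).
    by apply/funext => x; rewrite indicT mulr1 addrK.
  have mhM : measurable_fun setT (fun x => h x + M) by exact: measurable_funD.
  have bhM x : `|h x + M| <= M + M.
    by rewrite (le_trans (ler_normD _ _))// lerD// ger0_norm// (le_trans _ (hM x)).
  apply: exp_concentratedD.
  - apply: measurable_bounded_integrable => //; first by rewrite (le_lt_trans (probability_le1 _ _)) ?ltry.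
    exists (M + M); split; first exact: num_real.
    by move=> r Mr x _; apply: (le_trans (bhM x)); exact: ltW.
  - rewrite (_ : EFin \o _ = (fun x => ((- M)%:E * (\1_setT x)%:E)%E)); last by apply/funext.
    by apply: integrableZl => //; exact: integrable_indic.
  - apply: (wl _ (M + M)) => // x.
    by have := hM x; rewrite ler_norml; lra.
  - by apply: exp_concentratedZ; [exact: integrable_indic|exact: exp_concentrated_indic].
apply: exp_concentrated_uniform_limit.
  apply: measurable_bounded_integrable => //; first by rewrite (le_lt_trans (probability_le1 _ _)) ?ltry.
  exists M; split; first exact: num_real.
  by move=> r Mr x _; apply: (le_trans (hM x)); exact: ltW.
move=> s s0.
have [N MN] : exists N : nat, M < N.+1%:R * s.
  exists (Num.truncn (M / s)); rewrite -ltr_pdivrMr//; exact: truncnS_gt.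
pose A j := [set x | j.+1%:R * s <= h x].
have mA j : measurable (A j).
  by rewrite -[A j]setTI; exact: measurable_fun_le.
exists (fun x => \sum_(j < N) s * \1_(A j) x).
have [ig cg] : mu.-integrable setT (EFin \o (fun x => \sum_(j < N) s * \1_(A j) x)) /\
    exp_concentrated mu (fun x => \sum_(j < N) s * \1_(A j) x).
  elim: N {MN} => [|N [ig cg]].
    have -> : (fun x => \sum_(j < 0) s * \1_(A j) x) = (fun x => 0 * \1_setT x).
      by apply/funext => x; rewrite big_ord0 mul0r.
    split.
      rewrite (_ : EFin \o _ = (fun x => (0%:E * (\1_setT x)%:E)%E)); last by apply/funext.
      by apply: integrableZl => //; exact: integrable_indic.
    by apply: exp_concentratedZ; [exact: integrable_indic|exact: exp_concentrated_indic].
  have iN : mu.-integrable setT (EFin \o (fun x => s * \1_(A N) x)).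
    rewrite (_ : EFin \o _ = (fun x => (s%:E * (\1_(A N) x)%:E)%E)); last by apply/funext.
    by apply: integrableZl => //; exact: integrable_indic.
  have -> : (fun x => \sum_(j < N.+1) s * \1_(A j) x) =
            (fun x => \sum_(j < N) s * \1_(A j) x + s * \1_(A N) x).
    by apply/funext => x; rewrite big_ord_recr.
  split; first by apply: (integrableD _ ig iN).
  apply: exp_concentratedD => //.
  by apply: exp_concentratedZ; [exact: integrable_indic|exact: exp_concentrated_indic].
split=> // x.
have hN : h x < N.+1%:R * s by apply: le_lt_trans MN; rewrite (le_trans _ (hM x))// ler_norm.
have /= := layer_cake_approx s0 (h0 x) hN.
have -> : \sum_(j < N) s * (j.+1%:R * s <= h x)%R%:R = \sum_(j < N) s * \1_(A j) x.
  apply: eq_bigr => j _; congr (_ * _); rewrite indicE.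
  have [yle|ylt] := boolP (_ <= h x); first by rewrite mem_set.
  by rewrite memNset//; exact/negP.
by rewrite ler_norml; lra.
Qed.

(** Samples lie in [S] almost surely, and h agrees almost everywhere with its truncation to [S].
    This form suits the kernel 1/(z0 - x), bounded on the support but not near z0. *)
Lemma exp_concentrated_ae_bounded (R : realType) (mu : probability (R * R)%type R)
    (S : set (R * R)%type) (h : R * R -> R) (M : R) :
  measurable S -> mu (~` S) = 0 -> measurable_fun setT h ->
  (forall x, S x -> `|h x| <= M) -> exp_concentrated mu h.
Proof.
move=> mS S0 mh hM eta eta0.
pose g x := h x * \1_S x.
have gS x : S x -> g x = h x by move=> Sx; rewrite /g indicE mem_set// mulr1.
have mg : measurable_fun setT g by apply: measurable_funM => //; exact: measurable_indic.
have cg : exp_concentrated mu g.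
  apply: (@exp_concentrated_bounded _ _ _ (Num.max M 0)) => // x.
  have [Sx|nSx] := pselect (S x); first by rewrite gS// le_max hM.
  by rewrite /g indicE memNset// mulr0 normr0 le_max lexx orbT.
have -> : Rintegral mu setT h = Rintegral mu setT g.
  rewrite /Rintegral; congr fine; apply: ae_eq_integral => //;
    [exact/measurable_EFinP|exact/measurable_EFinP|].
  exists (~` S); split => //; first exact: measurableC.
  by move=> x /= nE Sx; apply: nE => _; rewrite gS.
move: (exp_likely_and (exp_likely_of_measure1 mS S0) (cg _ eta0)).
apply: exp_likely_sub => n x n0 [Sx].
by under eq_bigr => i _ do rewrite gS//.
Qed.

(** * Modulus, discs and the support of the measure *)

Lemma normcE_lt (R : realType) (z : R[i]) (r : R) :
  (`|z| < (r%:C)%C)%R = (Normc.normc z < r).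
Proof. by case: z => a b; rewrite -ltcR. Qed.

Lemma normcB_sym (R : realType) (z w : R[i]) :
  Normc.normc (z - w) = Normc.normc (w - z).
Proof. by rewrite -opprB; exact: normcN. Qed.

Lemma normc_triangle (R : realType) (x y z : R[i]) :
  Normc.normc (x - z) <= Normc.normc (x - y) + Normc.normc (y - z).
Proof. by rewrite -(subrKA y); exact: le_normcD. Qed.

Lemma normc_le_ReIm (R : realType) (z : R[i]) :
  Normc.normc z <= `|complex.Re z| + `|complex.Im z|.
Proof.
case: z => a b /=; rewrite -[leRHS]ger0_norm ?addr_ge0// -sqrtr_sqr ler_wsqrtr//.
rewrite sqrrD !real_normK ?num_real// lerD2r lerDl.
by rewrite mulrn_wge0// mulr_ge0.
Qed.

Lemma normr_Re_le (R : realType) (z : R[i]) : `|complex.Re z| <= Normc.normc z.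
Proof. by case: z => a b /=; rewrite -sqrtr_sqr ler_wsqrtr// lerDl sqr_ge0. Qed.

Lemma normr_Im_le (R : realType) (z : R[i]) : `|complex.Im z| <= Normc.normc z.
Proof. by case: z => a b /=; rewrite -sqrtr_sqr ler_wsqrtr// lerDr sqr_ge0. Qed.

Definition cdisc (R : realType) (x : (R * R)%type) (r : R) : set (R * R)%type :=
  [set y | Normc.normc (toC y - toC x) < r].

Lemma cdiscE (R : realType) (x y : (R * R)%type) (r : R) :
  cdisc x r y = (Normc.normc (toC y - toC x) < r) :> Prop.
Proof. by []. Qed.

Lemma measurable_cdisc (R : realType) (x : (R * R)%type) (r : R) :
  measurable (cdisc x r).
Proof.
have -> : cdisc x r =
    ~` (setT `&` [set y | r <= Num.sqrt ((y.1 - x.1) ^+ 2 + (y.2 - x.2) ^+ 2)]).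
  by rewrite setTI; apply/seteqP; split=> y; rewrite /cdisc/= ltNge => /negP.
apply: measurableC; apply: measurable_fun_le => //.
apply: measurableT_comp.
  by apply: continuous_measurable_fun; exact: sqrt_continuous.
by apply: measurable_funD; apply: measurable_funX; apply: measurable_funB.
Qed.

                                                                          
(** Discs with rational centre and radius form a countable family; its null members exhibit the
    complement of the support as a countable union of null sets. *)
Definition null_rat_disc (R : realType) (mu : probability (R * R)%type R)
    (p : (rat * rat * rat)%type) : set (R * R)%type :=
  let D := cdisc (ratr p.1.1 : R, ratr p.1.2 : R) (ratr p.2) in
  if `[< mu D = 0 >] then D else set0.

Lemma null_rat_discE (R : realType) (mu : probability (R * R)%type R) (a b s : rat) :
  null_rat_disc mu (a, b, s) =
  if `[< mu (cdisc (ratr a : R, ratr b : R) (ratr s)) = 0 >]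
  then cdisc (ratr a : R, ratr b : R) (ratr s) else set0.
Proof. by []. Qed.

Lemma setC_supp (R : realType) (mu : probability (R * R)%type R) :
  ~` supp mu = \bigcup_n oapp (null_rat_disc mu) set0 (unpickle n).
Proof.
apply/seteqP; split => [x /= nx|x [n _]].
  have [r r0 Dr] : exists2 r, 0 < r & mu (cdisc x r) = 0.
    apply: contrapT => h; apply: nx => r r0.
    rewrite (_ : [set y | _] = cdisc x r); last first.
      by apply/funext => y; rewrite /cdisc /= normcE_lt.
    by rewrite lt0e measure_ge0 andbT; apply/eqP => D0; apply: h; exists r.
  (* The rational centre will be within r/4 of x: s > r/4 puts x in the rational disc, and s < r/2
     keeps that disc inside the null disc of radius r about x. *)
  have [s sr] : exists s : rat, (ratr s \in `]r / 4, r / 2[)%R.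
    by apply: rat_in_itvoo; lra.
  move: sr; rewrite in_itv/= => /andP[rs sr].
  have [a xa] : exists a : rat, (ratr a \in `]x.1, x.1 + r / 8[)%R.
    by apply: rat_in_itvoo; lra.
  have [b xb] : exists b : rat, (ratr b \in `]x.2, x.2 + r / 8[)%R.
    by apply: rat_in_itvoo; lra.
  move: xa xb; rewrite !in_itv/= => /andP[xa1 xa2] /andP[xb1 xb2].
  exists (pickle (a, b, s)); [exact: I|rewrite pickleK /oapp null_rat_discE].
  have xq : Normc.normc (toC x - toC (ratr a, ratr b)) < ratr s.
    apply: (le_lt_trans (normc_le_ReIm _)); apply: lt_trans rs.
    have /= h1 : `|x.1 - ratr a| < r / 8 by rewrite ltr_norml; lra.
    have /= h2 : `|x.2 - ratr b| < r / 8 by rewrite ltr_norml; lra.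
    by apply: (lt_le_trans (ltrD h1 h2)); lra.
  rewrite asboolT//; apply: subset_measure0 Dr; [exact: measurable_cdisc|exact: measurable_cdisc|].
  move=> y; rewrite !cdiscE => yq.
  apply: (le_lt_trans (normc_triangle _ (toC (ratr a, ratr b)) _)).
  rewrite (normcB_sym _ (toC x)); lra.
case: (unpickle n) => //= -[[a b] s]; rewrite null_rat_discE.
case: asboolP => // D0; rewrite cdiscE => xD xS.
(* The slack of x in the rational disc: a disc of this radius about x stays inside it. *)
pose r := ratr s - Normc.normc (toC x - toC (ratr a, ratr b)).
have r0 : 0 < r by rewrite subr_gt0.
have := xS r r0; rewrite (_ : [set y | _] = cdisc x r); last first.
  by apply/funext => y; rewrite /cdisc /= normcE_lt.
rewrite (subset_measure0 _ _ _ D0) ?ltxx//; try exact: measurable_cdisc.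
move=> y; rewrite !cdiscE => yx.
apply: (le_lt_trans (normc_triangle _ (toC x) _)).
by rewrite -ltrBrDr.
Qed.

Lemma measurable_null_rat_disc (R : realType) (mu : probability (R * R)%type R) n :
  measurable (oapp (null_rat_disc mu) set0 (unpickle n)).
Proof.
case: (unpickle n) => //= p; rewrite /null_rat_disc.
by case: asboolP => // _; exact: measurable_cdisc.
Qed.

Lemma measurable_supp (R : realType) (mu : probability (R * R)%type R) :
  measurable (supp mu).
Proof.
rewrite -[supp mu]setCK setC_supp; apply: measurableC.
by apply: bigcup_measurable => n _; exact: measurable_null_rat_disc.
Qed.

Lemma measure_setC_supp (R : realType) (mu : probability (R * R)%type R) :
  mu (~` supp mu) = 0.
Proof.
rewrite setC_supp; apply: measure_negligible.
  by apply: bigcup_measurable => n _; exact: measurable_null_rat_disc.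
apply: negligible_bigcup => n.
apply/negligibleP; first exact: measurable_null_rat_disc.
case: (unpickle n) => [p|] /=; last exact: measure0.
by rewrite /null_rat_disc; case: asboolP => // _; exact: measure0.
Qed.

(** * Critical points as zeros of sums of reciprocals *)

Lemma deriv_prod_XsubC_horner (F : fieldType) (n : nat) (x : 'I_n -> F) (z : F) :
  (forall i, z != x i) ->
  (\prod_(i < n) ('X - (x i)%:P))^`().[z] =
  \prod_(i < n) (z - x i) * \sum_(i < n) (z - x i)^-1.
Proof.
elim: n x => [|n IH] x zx; first by rewrite !big_ord0 derivC horner0 mulr0.
rewrite !big_ord_recr/= derivM hornerD !hornerM IH// derivXsubC hornerC mulr1.
rewrite hornerXsubC horner_prod; under [X in _ + X]eq_bigr do rewrite hornerXsubC.
by field; rewrite subr_eq0.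
Qed.

Lemma sum_inv_critical (R : realType) (n : nat) (x : 'I_n -> (R * R)%type) (z : R[i]) :
  (forall i, z != toC (x i)) ->
  root (\prod_(i < n) ('X - (toC (x i))%:P))^`() z ->
  \sum_(i < n) (z - toC (x i))^-1 = 0.
Proof.
move=> zx /rootP; rewrite deriv_prod_XsubC_horner// => /eqP.
rewrite mulf_eq0 => /orP[|/eqP//].
by rewrite prodf_seq_eq0 => /hasP[i _]; rewrite subr_eq0 (negbTE (zx i)).
Qed.

Lemma ReV (R : realType) (w : R[i]) :
  complex.Re w^-1 = complex.Re w / (complex.Re w ^+ 2 + complex.Im w ^+ 2).
Proof. by case: w. Qed.

Lemma ImV (R : realType) (w : R[i]) :
  complex.Im w^-1 = - (complex.Im w / (complex.Re w ^+ 2 + complex.Im w ^+ 2)).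
Proof. by case: w. Qed.

Lemma ReD (R : realType) : {morph @complex.Re R : z w / z + w}.
Proof. by move=> [a b] [c d]. Qed.

Lemma ImD (R : realType) : {morph @complex.Im R : z w / z + w}.
Proof. by move=> [a b] [c d]. Qed.

                                                                 
(** Half-plane form of Gauss-Lucas: inversion preserves a positive real part, so the sum of the 1/(c
    w_i), which is 1/c times the given sum, has positive real part. *)
Lemma sum_inv_neq0 (R : realType) (n : nat) (w : 'I_n -> R[i]) (c : R[i]) :
  (0 < n)%N -> (forall i, 0 < complex.Re (c * w i)) ->
  \sum_(i < n) (w i)^-1 != 0.
Proof.
move=> n0 cw; apply/eqP => s0.
have : \sum_(i < n) complex.Re (c * w i)^-1 = 0.
  rewrite -(big_morph _ (@ReD R) (erefl (complex.Re (0 : R[i])))).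
  by under eq_bigr do rewrite invfM; rewrite -mulr_sumr s0 mulr0.
apply/eqP; rewrite gt_eqF//.
have pos i : 0 < complex.Re (c * w i)^-1.
  by rewrite ReV divr_gt0// ltr_pwDl ?sqr_ge0// exprn_gt0.
rewrite (bigD1 (Ordinal n0))//= ltr_pwDl//; apply: sumr_ge0 => i _; exact/ltW.
Qed.

(** * Measurability and Lipschitz bound for the kernel 1/(z - x) *)

(** On nonnegative reals inversion is the power -1, even at 0 where both give 0, and real powers are
    measurable. *)
Lemma measurable_funV_ge0 (R : realType) (g : R * R -> R) :
  measurable_fun setT g -> (forall x, 0 <= g x) -> measurable_fun setT (fun x => (g x)^-1).
Proof.
move=> mg g0.
have -> : (fun x => (g x)^-1) = (fun x => g x `^ (-1)).
  by apply/funext => x; rewrite powR_inv1.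
by apply: (measurableT_comp (measurable_powR (-1)) mg).
Qed.

Lemma measurable_normc2V (R : realType) (z : R[i]) :
  measurable_fun setT (fun x : (R * R)%type =>
    ((complex.Re z - x.1) ^+ 2 + (complex.Im z - x.2) ^+ 2)^-1).
Proof.
apply: measurable_funV_ge0 => [|x]; last by rewrite addr_ge0 ?sqr_ge0.
by apply: measurable_funD; apply: measurable_funX; apply: measurable_funB.
Qed.

Lemma measurable_Re_inv (R : realType) (z : R[i]) :
  measurable_fun setT (fun x : (R * R)%type => complex.Re ((z - toC x)^-1)).
Proof.
have -> : (fun x : (R * R)%type => complex.Re ((z - toC x)^-1)) = (fun x =>
    (complex.Re z - x.1) * ((complex.Re z - x.1) ^+ 2 + (complex.Im z - x.2) ^+ 2)^-1).
  by apply/funext => x; rewrite ReV; case: z.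
by apply: measurable_funM; [exact: measurable_funB|exact: measurable_normc2V].
Qed.

Lemma measurable_Im_inv (R : realType) (z : R[i]) :
  measurable_fun setT (fun x : (R * R)%type => complex.Im ((z - toC x)^-1)).
Proof.
have -> : (fun x : (R * R)%type => complex.Im ((z - toC x)^-1)) = (fun x =>
    (x.2 - complex.Im z) * ((complex.Re z - x.1) ^+ 2 + (complex.Im z - x.2) ^+ 2)^-1).
  by apply/funext => x; rewrite ImV -mulNr; case: z => a b /=; rewrite opprB.
by apply: measurable_funM; [exact: measurable_funB|exact: measurable_normc2V].
Qed.

Lemma normc_invB (R : realType) (z w : R[i]) (eps : R) : 0 < eps ->
  eps <= Normc.normc z -> eps <= Normc.normc w ->
  Normc.normc (z^-1 - w^-1) <= Normc.normc (z - w) / eps ^+ 2.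
Proof.
move=> e0 ez ew.
have nz0 (u : R[i]) : eps <= Normc.normc u -> u != 0.
  by move=> eu; apply: contraTneq eu => ->; rewrite Normc.normc0 -ltNge.
have -> : z^-1 - w^-1 = (w - z) * (z^-1 * w^-1).
  by rewrite mulrBl mulrCA divff ?nz0// mulr1 mulVKf ?nz0.
rewrite !Normc.normcM !Normc.normcV normcB_sym ler_wpM2l//.
  by case: (_ - _) => a b /=; exact: sqrtr_ge0.
rewrite expr2 invfM ler_pM ?invr_ge0 ?lef_pV2 ?posrE// ?(lt_le_trans e0)//.
all: by apply: ltW; apply: (lt_le_trans e0).
Qed.

(** * From neighbourhoods to compact sets *)

Lemma exp_likely_true (R : realType) (mu : probability (R * R)%type R)
    (Ev : forall n, ('I_n -> (R * R)%type) -> Prop) :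
  (forall n x, (0 < n)%N -> Ev n x) -> exp_likely mu Ev.
Proof.
move=> EvT.
apply: exp_likely_sub (exp_likely_of_measure1 (@measurableT _ (R * R)%type) _).
  by move=> n x n0 _; exact: EvT.
by rewrite setCT measure0.
Qed.

Lemma exp_likely_compact (R : realType) (mu : probability (R * R)%type R)
    (K : set (R * R)%type) (Q : R * R -> forall n, ('I_n -> (R * R)%type) -> Prop) :
  compact K ->
  (forall z0, K z0 -> exists2 U, nbhs z0 U &
     exp_likely mu (fun n x => forall z, U z -> Q z n x)) ->
  exp_likely mu (fun n x => forall z, K z -> Q z n x).
Proof.
move=> cK loc; apply: contrapT => nK.
                                                                              
                                                                          
(* The sets outside which the claim is exponentially likely form a filter, by [exp_likely_and], and
   it is proper if the claim fails on K. Compactness yields a cluster point z0 in K, yet the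
   complement of a neighbourhood of z0 belongs to [F]. *)
pose F := [set A | exp_likely mu (fun n x => forall z, K z -> ~ A z -> Q z n x)].
have FF : ProperFilter F.
  split.
    by move=> F0; apply: nK; apply: exp_likely_sub F0 => n x n0 H z Kz; exact: H.
  split.
  - by apply: exp_likely_true => n x n0 z _ [].
  - move=> A B FA FB; move: (exp_likely_and FA FB).
    apply: exp_likely_sub => n x n0 [HA HB] z Kz nAB.
    have [Az|nAz] := pselect (A z); last exact: HA.
    by apply: HB => // Bz; apply: nAB.
  - move=> A B AB; apply: exp_likely_sub => n x n0 HA z Kz nB.
    by apply: HA => // /AB.
have FK : F K by apply: exp_likely_true => n x n0 z Kz [].
have [z0 [Kz0 clz0]] := cK F FF FK.
have [U nU likU] := loc z0 Kz0.
have FU : F (~` U).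
  by apply: exp_likely_sub likU => n x n0 H z _ nnU; apply: H; exact: contrapT.
by have [y [/= ]] := clz0 _ _ FU nU.
Qed.

(** * No stray critical points near a given point *)

Lemma notin_Nmu_far (R : realType) (mu : probability (R * R)%type R) (eps : R)
    (z : R[i]) (x : (R * R)%type) :
  ~ Nmu mu eps z -> supp mu x -> eps <= Normc.normc (z - toC x).
Proof.
move=> nN Sx; rewrite leNgt; apply/negP => lt; apply: nN.
by exists (toC x); split; [left; exists x|rewrite normcE_lt].
Qed.

(** [L] stands for Re or Im. The sum at z0 deviates from n a by at most n|a|/4, and passing from z0
    to z costs at most n|a|/4 more; the total n|a|/2 is below n|a|, so the sum at z cannot
    vanish. *)
Lemma exp_likely_sum_inv_neq0 (R : realType) (mu : probability (R * R)%type R)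
    (eps : R) (L : R[i] -> R) (z0 : R[i]) :
  0 < eps -> {morph L : z w / z + w} -> (forall w, `|L w| <= Normc.normc w) ->
  measurable_fun setT (fun x => L (z0 - toC x)^-1) ->
  (forall x, supp mu x -> eps <= Normc.normc (z0 - toC x)) ->
  Rintegral mu setT (fun x => L (z0 - toC x)^-1) != 0 ->
  exists2 r : R, 0 < r & exp_likely mu (fun n x => forall z,
    Normc.normc (z - z0) < r -> (forall i, eps <= Normc.normc (z - toC (x i))) ->
    \sum_(i < n) (z - toC (x i))^-1 != 0).
Proof.
move=> e0 LD Lle mL far a0; set a := Rintegral _ _ _ in a0.
have L0 : L 0 = 0 by apply: (addIr (L 0)); rewrite -LD !add0r.
have LB z w : L (z - w) = L z - L w by apply: (addIr (L w)); rewrite -LD !subrK.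
have d0 : 0 < `|a| / 4 by rewrite divr_gt0// normr_gt0.
(* By [normc_invB], each term then moves by at most r / eps^2 = |a|/4. *)
exists (`|a| / 4 * eps ^+ 2); first by rewrite mulr_gt0// exprn_gt0.
have bL x : supp mu x -> `|L (z0 - toC x)^-1| <= eps^-1.
  move=> Sx; apply: (le_trans (Lle _)); rewrite Normc.normcV.
  by rewrite lef_pV2 ?posrE//; [exact: far|apply: (lt_le_trans e0); exact: far].
have conc := exp_concentrated_ae_bounded (measurable_supp mu) (measure_setC_supp mu) mL bL d0.
move: (exp_likely_and (exp_likely_of_measure1 (measurable_supp mu) (measure_setC_supp mu)) conc).
apply: exp_likely_sub => n x n0 [Sx]; rewrite -/a => dev z zz0 zx.
apply/eqP => s0.
have Ls0 : \sum_(i < n) L (z - toC (x i))^-1 = 0.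
  by rewrite -(big_morph _ LD L0) s0 L0.
have diff : `|\sum_(i < n) L (z - toC (x i))^-1 - \sum_(i < n) L (z0 - toC (x i))^-1|
    <= n%:R * (`|a| / 4).
  rewrite -sumrB; apply: (le_trans (ler_norm_sum _ _ _)).
  rewrite mulr_natl -[X in _ *+ X]card_ord -sumr_const.
  apply: ler_sum => i _; rewrite -LB; apply: (le_trans (Lle _)).
  apply: (le_trans (normc_invB e0 (zx i) (far _ (Sx i)))).
  by rewrite opprB addrA subrK ler_pdivrMr ?exprn_gt0//; exact: ltW.
rewrite Ls0 sub0r normrN in diff.
have n0' : 0 < n%:R :> R by rewrite ltr0n.
have na : `|n%:R * a| <= n%:R * (`|a| / 4) + n%:R * (`|a| / 4).
  rewrite -[n%:R * a](subKr (\sum_(i < n) L (z0 - toC (x i))^-1)).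
  by apply: (le_trans (ler_normB _ _)); rewrite lerD.
move: na; rewrite normrM (gtr0_norm n0') -mulrDr ler_pM2l//.
move: d0; lra.
Qed.

(** If z0 lies in the open set N_mu(eps), so does a ball about it. Otherwise m_mu(z0) is nonzero,
    and a critical point z outside N_mu(eps) is eps-far from all samples in the support, as the
    previous lemma requires. *)
Lemma exp_likely_critical_locally (R : realType) (mu : probability (R * R)%type R)
    (eps : R) (z0 : R[i]) : 0 < eps ->
  exists2 r : R, 0 < r & exp_likely mu (fun n x => forall z,
    Normc.normc (z - z0) < r ->
    root (\prod_(i < n) ('X - (toC (x i))%:P))^`() z -> Nmu mu eps z).
Proof.
move=> e0; have [[w [Hw zw]]|nN] := pselect (Nmu mu eps z0).
  rewrite normcE_lt in zw; exists (eps - Normc.normc (z0 - w)); first by rewrite subr_gt0.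
  apply: exp_likely_true => n x n0 z zz0 _; exists w; split => //.
  rewrite normcE_lt; apply: (le_lt_trans (normc_triangle _ z0 _)).
  by rewrite -ltrBrDr.
have far x : supp mu x -> eps <= Normc.normc (z0 - toC x) by exact: notin_Nmu_far.
have m0 : cauchy_transform mu z0 <> 0.
  move=> m0; apply: nN; exists z0; split; last by rewrite normcE_lt subrr Normc.normc0.
  right; split => // -[x Sx xz0].
  by move: (far x Sx); rewrite xz0 subrr Normc.normc0 leNgt e0.
suff [r r0 H] : exists2 r : R, 0 < r & exp_likely mu (fun n x => forall z,
    Normc.normc (z - z0) < r -> (forall i, eps <= Normc.normc (z - toC (x i))) ->
    \sum_(i < n) (z - toC (x i))^-1 != 0).
  exists r => //.
  move: (exp_likely_and (exp_likely_of_measure1 (measurable_supp mu) (measure_setC_supp mu)) H).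
  apply: exp_likely_sub => n x n0 [Sx Hx] z zz0 rz; apply: contrapT => nz.
  have zfar i : eps <= Normc.normc (z - toC (x i)) by exact: (notin_Nmu_far nz).
  move: (Hx z zz0 zfar); rewrite (sum_inv_critical _ rz) ?eqxx// => i.
  by apply: contraTneq (zfar i) => ->; rewrite subrr Normc.normc0 -ltNge.
(* Whichever of the real and imaginary parts of m_mu(z0) is nonzero serves as [L]. *)
have [Re0|Re0] := eqVneq (Rintegral mu setT (fun x => complex.Re (z0 - toC x)^-1)) 0.
  apply: (@exp_likely_sum_inv_neq0 _ _ _ (@complex.Im R)) => //.
  - exact: ImD.
  - exact: normr_Im_le.
  - exact: measurable_Im_inv.
  - by apply/eqP => Im0; apply: m0; rewrite /cauchy_transform Re0 Im0.
apply: (@exp_likely_sum_inv_neq0 _ _ _ (@complex.Re R)) => //.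
- exact: ReD.
- exact: normr_Re_le.
- exact: measurable_Re_inv.
Qed.

(** * Confinement to a square and conclusion *)

Lemma nbhs_toC (R : realType) (z0 : (R * R)%type) (r : R) : 0 < r ->
  nbhs z0 [set z | Normc.normc (toC z - toC z0) < r].
Proof.
move=> r0; have r20 : 0 < r / 2 by rewrite divr_gt0.
apply/nbhs_ballP; exists (r / 2) => [|z [z1 z2]]; first exact: r20.
change (Normc.normc (toC z - toC z0) < r).
apply: (le_lt_trans (normc_le_ReIm _)); rewrite [ltRHS]splitr.
by apply: ltrD; rewrite distrC.
Qed.

(** If z lay beyond a side of the square, all z - x_i would lie in one open half-plane, against
    [sum_inv_neq0]. The multipliers -1, 1, i, -i treat the left, right, lower and upper sides. *)
Lemma critical_point_in_square (R : realType) (B : R) (n : nat)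
    (x : 'I_n -> (R * R)%type) (z : R[i]) : (0 < n)%N ->
  (forall i, `|(x i).1| <= B /\ `|(x i).2| <= B) ->
  \sum_(i < n) (z - toC (x i))^-1 = 0 ->
  `|complex.Re z| <= B /\ `|complex.Im z| <= B.
Proof.
move=> n0 xB /eqP s0.
have out (c : R[i]) : ~ (forall i, 0 < complex.Re (c * (z - toC (x i)))).
  by move=> H; move: s0; apply/negP; exact: sum_inv_neq0 n0 H.
case: z {s0} out => a b out /=; rewrite !ler_norml.
have xle i : [/\ - B <= (x i).1, (x i).1 <= B, - B <= (x i).2 & (x i).2 <= B].
  by have [] := xB i; rewrite !ler_norml => /andP[? ?] /andP[? ?].
split; apply/andP; split; rewrite leNgt; apply/negP => lt.
- by apply: (out (- 1 +i* 0)%C) => i; have [] := xle i => ? ? ? ? /=; lra.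
- by apply: (out (1 +i* 0)%C) => i; have [] := xle i => ? ? ? ? /=; lra.
- by apply: (out (0 +i* 1)%C) => i; have [] := xle i => ? ? ? ? /=; lra.
- by apply: (out (0 +i* - 1)%C) => i; have [] := xle i => ? ? ? ? /=; lra.
Qed.

Lemma compact_square (R : realType) (K : set (R * R)%type) : compact K ->
  exists B : R, forall x, K x -> `|x.1| <= B /\ `|x.2| <= B.
Proof.
move=> cK; have [M [_ HM]] := compact_bounded cK.
exists (M + 1) => x Kx; have := HM (M + 1) _ x Kx.
by rewrite ltrDl => /(_ ltr01) /=; rewrite prod_normE num_ge_max => /andP[].
Qed.

Theorem mainTheorem2 (R : realType) (mu : probability (R * R)%type R) :
  compact (supp mu) ->
  forall eps : R, 0 < eps ->
  exists C c : R, 0 < C /\ 0 < c /\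
    forall n : nat, (0 < n)%N ->
    forall (d : measure_display) (Omega : measurableType d) (P : probability Omega R)
           (X : 'I_n -> Omega -> (R * R)%type),
      (forall i, measurable_fun setT (X i)) ->
      (forall i (A : set (R * R)%type), measurable A -> P (X i @^-1` A) = mu A) ->
      independent_rvs P X ->
      exists E : set Omega, measurable E /\
        E `<=` [set w | forall z : R[i], root (rand_poly X w)^`() z -> Nmu mu eps z] /\
        ((1 - C * expR (- (c * n%:R)))%:E <= P E)%E.
Proof.
move=> cS eps e0.
have [B SB] := compact_square cS.
pose K : set (R * R)%type := `[- B, B] `*` `[- B, B].
have likK : exp_likely mu (fun n x => forall z, K z ->
    root (\prod_(i < n) ('X - (toC (x i))%:P))^`() (toC z) -> Nmu mu eps (toC z)).
  apply: (exp_likely_compact (Q := fun z n x =>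
    root (\prod_(i < n) ('X - (toC (x i))%:P))^`() (toC z) -> Nmu mu eps (toC z))).
    by apply: compact_setX; exact: segment_compact.
  move=> z0 _; have [r r0 H] := exp_likely_critical_locally mu (toC z0) e0.
  exists [set z | Normc.normc (toC z - toC z0) < r]; first exact: nbhs_toC.
  by apply: exp_likely_sub H => n x n0 H z; exact: H.
have likS := exp_likely_of_measure1 (measurable_supp mu) (measure_setC_supp mu).
have [C [c [C0 [c0 H]]]] := exp_likely_and likS likK.
exists C, c; split=> //; split=> // n n0 d Om P X mX dX iX.
have [|E [mE [EE PE]]] := H n n0 d Om P X; first by split.
exists E; split=> //; split=> // w /EE [Sx Kx] z rz.
(* A critical point outside N_mu(eps) avoids the samples, hence is a zero of the sum of reciprocals
   and lies in [K], where the likely event rules it out. *)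
apply: contrapT => nz.
have s0 : \sum_(i < n) (z - toC (X i w))^-1 = 0.
  apply: sum_inv_critical rz => i.
  have := notin_Nmu_far nz (Sx i); apply: contraTneq => ->.
  by rewrite subrr Normc.normc0 -ltNge.
have [Rez Imz] := critical_point_in_square n0 (fun i => SB _ (Sx i)) s0.
have toCz : toC (complex.Re z, complex.Im z) = z by case: (z).
apply: nz; rewrite -toCz; apply: Kx; last by rewrite toCz.
by split; rewrite /= in_itv/= -ler_norml.
Qed.
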